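(* Let each $f_i:\mathbb{R}\to\mathbb{R}$, $i\in[N]$, be convex and differentiable with $|f_i'(s)-f_i'(t)|\le L_i|s-t|$ for all $s,t\in\mathbb{R}$, where $L_i>0$. Let $\mathcal G$ be the complete graph on $[N]$, let $2\le\tau\le N$, and let the probabilities be $$p_{\mathcal N}=\frac{\sum_{i\in\mathcal N}1/L_i}{\sum_{\mathcal M\in\mathcal P_\tau}\sum_{i\in\mathcal M}1/L_i}\qquad(\mathcal N\in\mathcal P_\tau).$$ Let $x^0\in S$ and let $R_1,\dots,R_N>0$ be constants such that for any $x$ satisfying $f(x)\le f(x^0)$ there exists $x^*\in X^*$ with $|x_i-x_i^*|\le R_i$ for all $i\in[N]$. Let $(x^k)_{k\ge0}$ be the random sequence generated from $x^0$ by algorithm $RCD_\tau$ with these probabilities and put $\phi_k=E[f(x^k)]$. Then for all $k\ge1$ $$\phi_k-f^*\le\frac{N-1}{\tau-1}\cdot\frac{2\sum_{i=1}^N L_iR_i^2}{k}.$$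
   Context: Problem: $f^*=\min\{f(x): x\in S\}$, where $f(x)=\sum_{i=1}^N f_i(x_i)$ for $x\in\mathbb{R}^N$ and $S=\{x\in\mathbb{R}^N:\sum_{i=1}^N x_i=0\}$; $X^*\subseteq S$ is the set of optimal solutions. $[N]=\{1,\dots,N\}$. $\mathcal P_\tau$ is the set of paths of $\tau$ vertices in the graph; each path is identified with its set of vertices, so for the complete graph $\mathcal P_\tau$ is the set of all $\tau$-element subsets of $[N]$. Algorithm $RCD_\tau$: start from $x^0\in S$. At iteration $k\ge0$, draw $\mathcal N_k\in\mathcal P_\tau$ (independently of the past) with $\Pr(\mathcal N_k=\mathcal N)=p_{\mathcal N}$; set $x_i^{k+1}=x_i^k$ for $i\notin\mathcal N_k$ and $x_i^{k+1}=x_i^k+d_i^k$ for $i\in\mathcal N_k$, where $$d_i^k=\frac1{L_i}\,\frac{\sum_{j\in\mathcal N_k}\frac1{L_j}\left(f_j'(x_j^k)-f_i'(x_i^k)\right)}{\sum_{j\in\mathcal N_k}\frac1{L_j}}.$$ *)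

(* Defs.v *)
From mathcomp Require Import all_boot all_order all_algebra.
From mathcomp Require Import all_classical all_reals all_analysis.

Set Implicit Arguments.
Unset Strict Implicit.
Unset Printing Implicit Defensive.

Import Order.TTheory GRing.Theory Num.Theory.
Import numFieldNormedType.Exports.

Local Open Scope classical_set_scope.
Local Open Scope ring_scope.

Definition objective (R : realType) (N : nat) (f : 'I_N -> R -> R)
    (x : 'rV[R]_N) : R :=
  \sum_(i < N) f i (x 0 i).

Definition feasible (R : realType) (N : nat) : set 'rV[R]_N :=
  [set x | \sum_(i < N) x 0 i = 0].

Definition optimal_set (R : realType) (N : nat) (f : 'I_N -> R -> R) :
    set 'rV[R]_N :=
  [set x | feasible x /\ forall y, feasible y -> objective f x <= objective f y].

Definition is_minimum (R : realType) (A : set R) (m : R) : Prop :=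
  A m /\ forall a, A a -> m <= a.

(* A simple graph on ['I_N] is given by its adjacency relation. *)
Definition complete_graph (N : nat) : rel 'I_N := fun i j => i != j.

(* Vertex sets of the paths with [tau] pairwise distinct vertices. *)
Definition path_sets (N : nat) (e : rel 'I_N) (tau : nat) : {set {set 'I_N}} :=
  [set A : {set 'I_N} |
     [exists t : tau.-tuple 'I_N,
        [&& uniq t, sorted e t & A == [set i in tval t]%SET]]]%SET.

Definition path_prob (R : realType) (N : nat) (e : rel 'I_N) (tau : nat)
    (L : 'I_N -> R) (A : {set 'I_N}) : R :=
  (\sum_(i in A) (L i)^-1) /
  (\sum_(B in path_sets e tau) \sum_(i in B) (L i)^-1).

Definition rcd_dir (R : realType) (N : nat) (f : 'I_N -> R -> R)
    (L : 'I_N -> R) (A : {set 'I_N}) (x : 'rV[R]_N) (i : 'I_N) : R :=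
  (L i)^-1 *
  ((\sum_(j in A) (L j)^-1 * (derive1 (f j) (x 0 j) - derive1 (f i) (x 0 i))) /
   (\sum_(j in A) (L j)^-1)).

Definition rcd_step (R : realType) (N : nat) (f : 'I_N -> R -> R)
    (L : 'I_N -> R) (A : {set 'I_N}) (x : 'rV[R]_N) : 'rV[R]_N :=
  \row_(i < N) (if i \in A then x 0 i + rcd_dir f L A x i else x 0 i).

Fixpoint rcd (R : realType) (N : nat) (f : 'I_N -> R -> R) (L : 'I_N -> R)
    (x0 : 'rV[R]_N) (A : nat -> {set 'I_N}) (k : nat) : 'rV[R]_N :=
  if k is k'.+1 then rcd_step f L (A k') (rcd f L x0 A k') else x0.

(* For a finite-valued process started from a deterministic point, the past at
   time [k] is the sigma-algebra generated by the draws [X 0], ..., [X k.-1]. *)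
Definition independent_of_past (d : measure_display) (T : measurableType d)
    (R : realType) (P : probability T R) (V : finType) (X : nat -> T -> V) :
    Prop :=
  forall (k : nat) (B : set V) (H : set {ffun 'I_k -> V}),
    let past := fun w : T => [ffun j : 'I_k => X j w] in
    P (X k @^-1` B `&` past @^-1` H) = (P (X k @^-1` B) * P (past @^-1` H))%E.

(* Main.v *)
(* Write [w_i = 1 / L_i] and [g_i = f_i'(x_i)].  A step on the block [A] moves
   coordinate [i] by [w_i (m - g_i)], with [m] the [w]-mean of [g] over [A], so by
   the descent lemma it decreases the objective by at least [V_A / 2], where
   [V_A = \sum_(i in A) w_i (g_i - m)^2].  As [A] is drawn with probability
   proportional to [Z_A = \sum_(i in A) w_i] and
   [Z_A V_A = 1/2 \sum_(i, j in A) w_i w_j (g_i - g_j)^2], counting the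
   [tau]-subsets through one point and through two points gives
   [E V_A = (tau - 1) / (N - 1) V_[N]].  Convexity and Cauchy-Schwarz bound the
   square of the gap [f(x) - f^*] by [(\sum_i L_i R_i^2) V_[N]].  Hence the expected
   gaps satisfy [del_(k+1) <= del_k - a del_k^2], which forces [del_k <= 1 / (a k)].
   Instead of Jensen's inequality, [gap^2] is bounded below by its tangent
   [2 m gap - m^2] at [m = del_k], which is affine in the gap. *)
Require Import Defs.
From mathcomp Require Import all_boot all_order all_algebra.
From mathcomp Require Import all_classical all_reals all_analysis.
From mathcomp Require Import ring lra.

Import Order.TTheory GRing.Theory Num.Theory.
Import numFieldNormedType.Exports.

Local Open Scope classical_set_scope.
Local Open Scope ring_scope.

(** * One-variable inequalities from smoothness and convexity *)

(** The difference [psi] between [f] and the quadratic has a derivative that is nonnegative left of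
    [x] and nonpositive right of it, so the mean value theorem on either side shows that [psi] is
    largest at [x]. *)
Lemma smooth_upper_bound {R : realType} (f : R -> R) (L : R) (x y : R) :
  (forall t : R, derivable f t 1) ->
  (forall s t : R, derive1 f s - derive1 f t <= L * `|s - t|) ->
  f y <= f x + derive1 f x * (y - x) + L / 2 * (y - x) ^+ 2.
Proof.
move=> f_derivable f_lipschitz.
pose psi (s : R) : R := f s - (derive1 f x * s + L / 2 * (s - x) ^+ 2).
pose dpsi (s : R) : R := derive1 f s - (derive1 f x + L * (s - x)).
have psiE (s : R) : is_derive s (1 : R) psi (dpsi s).
  have ? : is_derive s (1 : R) f (derive1 f s).
    by rewrite derive1E; apply: derivableP.
  rewrite /psi /dpsi; apply: is_derive_eq.
  rewrite /GRing.scale /=. lra.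
have psi_cont (a b : R) : {within `[a, b], continuous psi}.
  apply: derivable_within_continuous => s _; exact: ex_derive.
have psiy : psi y <= psi x.
  have [xy|/ltW yx] := leP x y.
    have [c] := MVT_segment xy (fun s _ => psiE s) (psi_cont x y).
    rewrite in_itv /= => /andP[xc _] E.
    rewrite -subr_le0 E mulr_le0_ge0 ?subr_ge0 //.
    have := f_lipschitz c x; rewrite ger0_norm ?subr_ge0 // /dpsi; lra.
  have [c] := MVT_segment yx (fun s _ => psiE s) (psi_cont y x).
  rewrite in_itv /= => /andP[_ cx] E.
  rewrite -subr_ge0 E mulr_ge0 ?subr_ge0 //.
  have := f_lipschitz x c; rewrite ger0_norm ?subr_ge0 // /dpsi; lra.
by move: psiy; rewrite /psi; lra.
Qed.

(** [smooth_upper_bound] for [- f] bounds [f] below by its tangent minus a quadratic. A violation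
    [e] of the tangent inequality at [y] passes by convexity to [x + s * (y - x)] with size at least
    [s * e], while the lower bound allows only [s ^+ 2 * C]; a small [s] is contradictory. *)
Lemma convex_above_tangent {R : realType} (f : R -> R) (L : R) (x y : R) :
  (forall t : R, derivable f t 1) ->
  (forall s t : R, `|derive1 f s - derive1 f t| <= L * `|s - t|) ->
  convex_function [set: convex_lmodType R^o] f ->
  f x + derive1 f x * (y - x) <= f y.
Proof.
move=> f_derivable f_lipschitz f_convex.
have L0 : 0 <= L.
  by have := le_trans (normr_ge0 _) (f_lipschitz 1 0); rewrite subr0 normr1 mulr1.
have lower z : f x + derive1 f x * (z - x) - L / 2 * (z - x) ^+ 2 <= f z.
  have df t : derivable (- f) t 1 by apply: derivableN.
  have d1 t : derive1 (- f) t = - derive1 f t by rewrite derive1N.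
  have lip s t : derive1 (- f) s - derive1 (- f) t <= L * `|s - t|.
    rewrite !d1 -opprD; apply: le_trans (f_lipschitz s t).
    by rewrite -normrN ler_norm.
  have := @smooth_upper_bound _ (- f) L x z df lip.
  by rewrite d1 /= !fctE; lra.
rewrite leNgt; apply/negP => gap.
set e := f x + derive1 f x * (y - x) - f y.
set C := L / 2 * (y - x) ^+ 2.
have e0 : 0 < e by rewrite subr_gt0.
have C0 : 0 <= C by rewrite mulr_ge0 ?sqr_ge0 // divr_ge0.
have eC : 0 < C + e by rewrite ltr_wpDl.
(* This choice gives [s * C < e] and [s <= 1], and its denominator is positive even when [C = 0]. *)
pose s := e / (C + e).
have s0 : 0 < s by rewrite divr_gt0.
have s1 : 0 <= 1 - s by rewrite subr_ge0 ler_pdivrMr // mul1r lerDr.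
have s1' : 1 - s <= 1 by rewrite gerBl ltW.
have := f_convex (Itv01 s1 s1') x y.
rewrite !inE => /(_ I I).
rewrite convRE /= /unstable.onem.
have -> : (conv (Itv01 s1 s1') (x : convex_lmodType R^o) (y : convex_lmodType R^o) : R) =
    x + s * (y - x).
  transitivity ((1 - s) * x + (1 - (1 - s)) * y); last by ring.
  by [].
move: (lower (x + s * (y - x))) => /le_trans /[apply].
rewrite -subr_ge0 (_ : _ - (_ - _) = s * (s * C - e)); last by rewrite /C /e; ring.
rewrite pmulr_rge0 // subr_ge0 /s mulrAC ler_pdivlMr //.
by rewrite ler_pM2l // gerDl leNgt e0.
Qed.

(** * Weighted mean and variance over a block *)

Definition wmean {R : fieldType} {I : finType} (w g : I -> R) (A : {set I}) : R :=
  (\sum_(i in A) w i * g i) / \sum_(i in A) w i.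

Definition wvar {R : fieldType} {I : finType} (w g : I -> R) (A : {set I}) : R :=
  \sum_(i in A) w i * (g i - wmean w g A) ^+ 2.

Section weighted_variance.
Context {R : realFieldType} {I : finType} (w g : I -> R).
Hypothesis w_gt0 : forall i, 0 < w i.

Lemma wsum_gt0 (A : {set I}) i : i \in A -> 0 < \sum_(i in A) w i.
Proof.
move=> iA; rewrite (bigD1 i) //= ltr_pwDl //.
by apply: sumr_ge0 => j _; apply: ltW.
Qed.

Lemma wsum_dev (A : {set I}) : \sum_(i in A) w i * (g i - wmean w g A) = 0.
Proof.
have [->|[i iA]] := set_0Vmem A; first by rewrite big_set0.
under eq_bigr do rewrite mulrBr.
rewrite sumrB -mulr_suml mulrCA divff ?mulr1 ?subrr //.
by rewrite gt_eqF // (wsum_gt0 _ _ iA).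
Qed.

Lemma wvar_ge0 (A : {set I}) : 0 <= wvar w g A.
Proof. by apply: sumr_ge0 => i _; rewrite mulr_ge0 ?sqr_ge0 // ltW. Qed.

(** Write [g i - g j] as [u i - u j] and expand: the cross terms vanish by [wsum_dev]. The
    right-hand side is free of the block mean, so it can be summed over blocks by counting pairs. *)
Lemma wvar_pairs (A : {set I}) :
  (\sum_(i in A) w i) * wvar w g A =
  2^-1 * \sum_(i in A) \sum_(j in A) w i * w j * (g i - g j) ^+ 2.
Proof.
pose u i := g i - wmean w g A.
have u0 : \sum_(i in A) w i * u i = 0 by apply: wsum_dev.
have E i : \sum_(j in A) w i * w j * (g i - g j) ^+ 2 =
   w i * u i ^+ 2 * (\sum_(j in A) w j) + w i * wvar w g A.
  transitivity (w i * u i ^+ 2 * (\sum_(j in A) w j) + w i * wvar w g A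
     - 2 * w i * u i * \sum_(j in A) w j * u j); last by rewrite u0 mulr0 subr0.
  rewrite !mulr_sumr -big_split -sumrB /=; apply: eq_bigr => j _.
  by rewrite -/(u j) /u; ring.
rewrite (eq_bigr _ (fun i _ => E i)).
rewrite big_split /= -!mulr_suml /=.
have -> : \sum_(i in A) w i * u i ^+ 2 = wvar w g A by [].
lra.
Qed.

(* Cauchy-Schwarz, after shifting [g] by its mean, which is free as [z] sums to zero. *)
Lemma wvar_cauchy_schwarz (z : I -> R) (D : R) : 0 < D ->
  \sum_i z i = 0 -> \sum_i z i ^+ 2 / w i <= D ->
  (\sum_i g i * z i) ^+ 2 <= D * wvar w g [set: I]%SET.
Proof.
move=> D0 z0 zD.
set m := wmean w g [set: I]%SET; set V := wvar _ _ _.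
pose u i := g i - m.
have -> : \sum_i g i * z i = \sum_i u i * z i.
  under [RHS]eq_bigr do rewrite mulrBl.
  by rewrite sumrB -mulr_sumr z0 mulr0 subr0.
have [S SE] : exists S, S = \sum_i u i * z i by exists (\sum_i u i * z i).
rewrite -SE.
have VE : V = \sum_i w i * u i ^+ 2.
  by rewrite /V /wvar; apply: eq_bigl => i; rewrite inE.
(* Expanding this square and using [zD] yields [0 <= D * (D * V - S ^+ 2)]. *)
have : 0 <= \sum_i w i * (D * u i - S * z i / w i) ^+ 2.
  by apply: sumr_ge0 => i _; rewrite mulr_ge0 ?sqr_ge0 // ltW.
have -> : \sum_i w i * (D * u i - S * z i / w i) ^+ 2 =
  D ^+ 2 * V - 2 * D * S * (\sum_i u i * z i) + S ^+ 2 * \sum_i z i ^+ 2 / w i.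
  rewrite VE !mulr_sumr -sumrB -big_split /=; apply: eq_bigr => i _.
  by field; rewrite gt_eqF.
have : S ^+ 2 * \sum_i z i ^+ 2 / w i <= S ^+ 2 * D by rewrite ler_wpM2l ?sqr_ge0.
rewrite -SE => h1 h2; rewrite -(ler_pM2l D0); lra.
Qed.

End weighted_variance.

(** * Counting blocks *)

(** Adjacency is disequality here, so every repetition-free enumeration of a set is a path. *)
Lemma path_sets_complete (N tau : nat) :
  path_sets (@complete_graph N) tau = [set A : {set 'I_N} | #|A| == tau]%SET.
Proof.
apply/finset.setP => A; rewrite !inE; apply/existsP/eqP => [[t /and3P[ut _ /eqP ->]]|cA].
  rewrite cardsE (card_uniqP ut); exact: size_tuple.
have sA : size (enum A) == tau by rewrite -cardE cA.
exists (Tuple sA); rewrite /= enum_uniq /=; apply/andP; split.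
  by apply: pairwise_sorted; rewrite -uniq_pairwise enum_uniq.
by apply/eqP/finset.setP => i; rewrite inE mem_enum.
Qed.

(** [C |-> B :|: C] is a bijection from the [k]-subsets of the complement of [B], with inverse
    [A |-> A :\: B]. *)
Lemma card_draws_supset (I : finType) (B : {set I}) (k : nat) :
  #|[set A : {set I} | (B \subset A) && (#|A| == #|B| + k)%N]%SET| = 'C(#|I| - #|B|, k).
Proof.
rewrite -(cardC (mem B)) addKn.
have <- : #|(~: B)%SET| = #|[predC B]| by apply: eq_card => i; rewrite !inE.
rewrite -cards_draws -[RHS](card_in_imset (f := fun C : {set I} => (B :|: C)%SET)); last first.
  move=> C D; rewrite !inE => /andP[CB _] /andP[DB _] /(congr1 (fun E => E :\: B)%SET).
  rewrite /= !finset.setDUl !finset.setDv !finset.set0U.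
  by move: CB DB; rewrite -!finset.disjoints_subset => /finset.setDidPl -> /finset.setDidPl ->.
apply: eq_card => A; rewrite inE; apply/andP/imsetP.
  move=> [BA /eqP cA]; exists (A :\: B)%SET; last first.
    by rewrite finset.setDE finset.setUIr finset.setUCr finset.setIT; apply/esym/finset.setUidPr.
  by rewrite inE cardsDS // cA addKn eqxx andbT finset.setDE finset.subsetIr.
move=> [C]; rewrite inE => /andP[CB /eqP <-] ->; split; first exact: finset.subsetUl.
rewrite cardsU; suff -> : (B :&: C = finset.set0)%SET by rewrite cards0 subn0.
by apply/eqP; rewrite finset.setIC finset.setI_eq0 finset.disjoints_subset.
Qed.

Section draws.
Context {R : realFieldType} {I : finType} (t : nat).

Lemma sum_draws1 (F : I -> R) :
  \sum_(A in [set A : {set I} | #|A| == t.+2]%SET) \sum_(i in A) F i =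
  'C(#|I|.-1, t.+1)%:R * \sum_i F i.
Proof.
rewrite (exchange_big_dep predT) //= mulr_sumr; apply: eq_bigr => i _.
rewrite sumr_const -[LHS]mulr_natl; congr (_%:R * _).
rewrite -subn1 -(cards1 i) -card_draws_supset; apply: eq_card => A.
by rewrite !inE cards1 finset.sub1set unfold_in /= inE andbC.
Qed.

(** Two distinct points lie in ['C(#|I|.-2, t)] common blocks. A diagonal pair would be counted as a
    single point, hence the condition on [F i i]. *)
Lemma sum_draws2 (F : I -> I -> R) : (forall i, F i i = 0) ->
  \sum_(A in [set A : {set I} | #|A| == t.+2]%SET) \sum_(i in A) \sum_(j in A) F i j =
  'C(#|I|.-2, t)%:R * \sum_i \sum_j F i j.
Proof.
move=> F0.
rewrite (exchange_big_dep predT) //= mulr_sumr; apply: eq_bigr => i _.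
rewrite (exchange_big_dep predT) //= mulr_sumr; apply: eq_bigr => j _.
have [<-|ij] := eqVneq i j; first by rewrite F0 mulr0 big1.
rewrite sumr_const -[LHS]mulr_natl; congr (_%:R * _).
have cij : #|[set i; j]%SET| = 2%N by rewrite cards2 ij.
rewrite -subn2 -cij -card_draws_supset; apply: eq_card => A.
rewrite !inE cij finset.subUset !finset.sub1set unfold_in /= !inE.
by rewrite -andbA andbC.
Qed.

(* The two counts above combine as [C(n-1, t+1) (t+1) = (n-1) C(n-2, t)]. *)
Lemma mean_wvar_draws (w g : I -> R) : (forall i, 0 < w i) ->
  (#|I|.-1)%:R * (\sum_(A in [set A : {set I} | #|A| == t.+2]%SET)
     (\sum_(i in A) w i) * wvar w g A) =
  t.+1%:R * (\sum_(A in [set A : {set I} | #|A| == t.+2]%SET) \sum_(i in A) w i)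
     * wvar w g [set: I]%SET.
Proof.
move=> w0.
under eq_bigr do rewrite wvar_pairs //.
rewrite -mulr_sumr sum_draws2; last by move=> i; rewrite subrr expr0n mulr0.
have pairs : (\sum_i w i) * wvar w g [set: I]%SET =
    2^-1 * \sum_i \sum_j w i * w j * (g i - g j) ^+ 2.
  have inT (F : I -> R) : \sum_(i in [set: I]%SET) F i = \sum_i F i.
    by apply: eq_bigl => i; rewrite inE.
  have := wvar_pairs w g w0 [set: I]%SET; rewrite !inT => ->.
  by congr (_ * _); apply: eq_bigr => i _; rewrite inT.
have : #|I|.-1%:R * 'C(#|I|.-2, t)%:R = t.+1%:R * 'C(#|I|.-1, t.+1)%:R :> R.
  by rewrite -!natrM mul_bin_diag.
move=> count; rewrite sum_draws1.
set P := \sum_i \sum_j _ in pairs *.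
transitivity ((#|I|.-1%:R * 'C(#|I|.-2, t)%:R) * (2^-1 * P)); first by ring.
by rewrite count -pairs; ring.
Qed.
End draws.

(** * Decrease of the objective in one step *)

Section rcd_step.
Context {R : realType} {N : nat} {f : 'I_N -> R -> R} {L : 'I_N -> R}.
Hypothesis f_convex : forall i : 'I_N, convex_function [set: convex_lmodType R^o] (f i).
Hypothesis f_derivable : forall (i : 'I_N) (t : R), derivable (f i) t 1.
Hypothesis L_gt0 : forall i : 'I_N, 0 < L i.
Hypothesis f_lipschitz : forall (i : 'I_N) (s t : R),
  `|derive1 (f i) s - derive1 (f i) t| <= L i * `|s - t|.

Let w (i : 'I_N) : R := (L i)^-1.
Let grad (x : 'rV[R]_N) (i : 'I_N) : R := derive1 (f i) (x 0 i).

Let w_gt0 i : 0 < w i. Proof. by rewrite invr_gt0. Qed.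

Lemma rcd_dirE (A : {set 'I_N}) (x : 'rV[R]_N) (i : 'I_N) : i \in A ->
  rcd_dir f L A x i = w i * (wmean w (grad x) A - grad x i).
Proof.
move=> iA; rewrite /rcd_dir; congr (_ * _).
under eq_bigr do rewrite mulrBr.
rewrite sumrB mulrBl -mulr_suml mulrAC divff ?mul1r //.
by rewrite gt_eqF // (@wsum_gt0 _ _ w w_gt0 _ _ iA).
Qed.

(** The moves are weighted deviations from the block mean, and these cancel by [wsum_dev]. *)
Lemma feasible_rcd_step (A : {set 'I_N}) (x : 'rV[R]_N) :
  feasible x -> feasible (rcd_step f L A x).
Proof.
rewrite /feasible /= => x0.
under eq_bigr do rewrite mxE.
transitivity (\sum_i (x 0 i + (if i \in A then rcd_dir f L A x i else 0))).
  by apply: eq_bigr => i _; case: ifP => // _; rewrite addr0.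
rewrite big_split /= x0 add0r -big_mkcond /=.
rewrite (eq_bigr _ (fun i iA => rcd_dirE A x i iA)).
under eq_bigr do rewrite -opprB mulrN.
by rewrite sumrN wsum_dev // oppr0.
Qed.

Lemma objective_rcd_step (A : {set 'I_N}) (x : 'rV[R]_N) :
  objective f (rcd_step f L A x) <= objective f x - 2^-1 * wvar w (grad x) A.
Proof.
pose m := wmean w (grad x) A.
(* Coordinate [i] alone decreases by [w i * (grad x i - m) ^+ 2 / 2] only up to a term
   [m * (w i * (grad x i - m))]. Adding this zero sum makes the bound provable termwise. *)
have dev0 : \sum_(i in A) m * (w i * (grad x i - m)) = 0.
  by rewrite -mulr_sumr wsum_dev // mulr0.
rewrite -[leRHS]subr0 -[X in _ - X]dev0 /objective /wvar mulr_sumr -addrA -opprD -big_split /=.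
rewrite [X in _ - X]big_mkcond /= -sumrB; apply: ler_sum => i _.
rewrite mxE; case: ifP => iA; last by rewrite subr0.
have lip s t : derive1 (f i) s - derive1 (f i) t <= L i * `|s - t|.
  exact: le_trans (ler_norm _) (f_lipschitz i s t).
have := @smooth_upper_bound _ (f i) (L i) (x 0 i) (x 0 i + rcd_dir f L A x i)
  (f_derivable i) lip.
rewrite [x 0 i + _]addrC addrK rcd_dirE // -/(grad x i) -/m => /le_trans; apply.
rewrite le_eqVlt; apply/orP; left; apply/eqP.
have wL : w i * L i = 1 by rewrite /w mulVf // gt_eqF.
set g := grad x i.
transitivity (f i (x 0 i) + g * (w i * (m - g)) + (w i * L i) * (w i * (m - g) ^+ 2) / 2).
  by field.
by rewrite wL; field.
Qed.

(** The tangent inequality bounds the gap by the pairing of the gradient with [x - xs], whose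
    coordinates sum to zero by feasibility, so [wvar_cauchy_schwarz] applies. Nonnegativity of the
    gap permits squaring. *)
Lemma objective_gap_sqr (x xs : 'rV[R]_N) (rho : 'I_N -> R) :
  feasible x -> feasible xs -> (forall i, 0 < rho i) ->
  (forall i, `|x 0 i - xs 0 i| <= rho i) -> 0 < \sum_i L i * rho i ^+ 2 ->
  0 <= objective f x - objective f xs ->
  (objective f x - objective f xs) ^+ 2 <=
    (\sum_i L i * rho i ^+ 2) * wvar w (grad x) [set: 'I_N]%SET.
Proof.
move=> x0 xs0 rho0 x_near D0 gap0.
have gap_le : objective f x - objective f xs <= \sum_i grad x i * (x 0 i - xs 0 i).
  rewrite /objective -sumrB; apply: ler_sum => i _.
  have := convex_above_tangent (f i) (L i) (x 0 i) (xs 0 i) (f_derivable i)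
    (f_lipschitz i) (f_convex i).
  rewrite -/(grad x i); lra.
apply: (@le_trans _ _ ((\sum_i grad x i * (x 0 i - xs 0 i)) ^+ 2)).
  by rewrite lerXn2r ?nnegrE // (le_trans gap0).
apply: wvar_cauchy_schwarz => //.
  by rewrite sumrB x0 xs0 subrr.
apply: ler_sum => i _; rewrite invrK mulrC ler_pM2l //.
by rewrite -real_normK ?num_real // lerXn2r ?nnegrE // ltW.
Qed.

(** [mean_wvar_draws] averages the decrease over the blocks. The free [m] allows one tangent point
    to serve all possible current iterates. *)
Lemma expected_gap_rcd_step (tau : nat) (x xs : 'rV[R]_N) (rho : 'I_N -> R) (m : R) :
  (2 <= tau)%N -> (tau <= N)%N ->
  feasible x -> feasible xs -> (forall i, 0 < rho i) ->
  (forall i, `|x 0 i - xs 0 i| <= rho i) ->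
  0 <= objective f x - objective f xs ->
  \sum_(A in path_sets (@complete_graph N) tau)
     path_prob (@complete_graph N) tau L A * (objective f (rcd_step f L A x) - objective f xs) <=
  objective f x - objective f xs
  - (tau%:R - 1) / (2 * (N%:R - 1) * \sum_i L i * rho i ^+ 2)
    * (2 * m * (objective f x - objective f xs) - m ^+ 2).
Proof.
move=> tau2 tauN x0 xs0 rho0 x_near gap0.
case: tau tau2 tauN => [//|[//|t]] _ tN.
have N2 : (1 < N)%N by apply: leq_trans tN.
have i0 : 'I_N := Ordinal (ltnW N2).
set D := \sum_i L i * rho i ^+ 2; set del := objective f x - objective f xs.
have D0 : 0 < D.
  rewrite /D (bigD1 i0) //= ltr_pwDl ?mulr_gt0 ?exprn_gt0 //.
  by apply: sumr_ge0 => i _; rewrite mulr_ge0 ?sqr_ge0 // ltW.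
rewrite /path_prob; set W := \sum_(B in path_sets _ _) _.
have W0 : 0 < W.
  rewrite /W path_sets_complete sum_draws1 mulr_gt0 //.
    by rewrite ltr0n bin_gt0 card_ord -ltnS prednK // (ltnW N2).
  by have := wsum_gt0 w w_gt0 [set: 'I_N]%SET i0 (finset.in_setT _); under eq_bigl do rewrite inE.
pose V := wvar w (grad x) [set: 'I_N]%SET.
have meanV := mean_wvar_draws t w (grad x) w_gt0.
rewrite card_ord -path_sets_complete -/W -/V in meanV.
have N1 : N.-1%:R = N%:R - 1 :> R by rewrite -subn1 natrB // ltnW.
have t1 : t.+2%:R - 1 = t.+1%:R :> R by rewrite -[t.+2]addn1 natrD addrK.
have N10 : 0 < N%:R - 1 :> R by rewrite subr_gt0 ltr1n.
apply: (@le_trans _ _ (del - 2^-1 * (t.+1%:R / (N%:R - 1) * V))).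
  apply: (@le_trans _ _ (\sum_(A in path_sets (@complete_graph N) t.+2)
     ((\sum_(i in A) w i) * (del / W) - (\sum_(i in A) w i) * wvar w (grad x) A * (2^-1 / W)))).
    apply: ler_sum => A _.
    have ZA : 0 <= (\sum_(i in A) w i) / W.
      by rewrite divr_ge0 ?(ltW W0) // sumr_ge0 // => i _; apply: ltW.
    have := ler_wpM2l ZA (objective_rcd_step A x).
    rewrite /del; lra.
  rewrite sumrB -!mulr_suml -/W mulrCA divff ?gt_eqF // mulr1 lerD2l lerN2.
  rewrite le_eqVlt; apply/orP; left; apply/eqP.
  move: meanV; rewrite N1; set Q := \sum_(A in _) _ * _ => meanV.
  have -> : Q = t.+1%:R * W * V / (N%:R - 1).
    by rewrite -meanV mulrAC divff ?mul1r // gt_eqF.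
  by field; rewrite !gt_eqF.
rewrite lerD2l lerN2 t1.
(* The tangent to the square at [m] lies below it, with defect [(del - m) ^+ 2]. *)
have V_ge : 2 * m * del - m ^+ 2 <= D * V.
  apply: le_trans (objective_gap_sqr x xs rho x0 xs0 rho0 x_near D0 gap0).
  rewrite -subr_ge0 (_ : _ - _ = (del - m) ^+ 2) ?sqr_ge0 //.
  by rewrite /del; ring.
have -> : 2^-1 * (t.+1%:R / (N%:R - 1) * V) = t.+1%:R / (2 * (N%:R - 1) * D) * (D * V).
  by field; rewrite !gt_eqF.
by rewrite ler_wpM2l // divr_ge0 ?ler0n // !mulr_ge0 // ltW.
Qed.
End rcd_step.

(** * Expectations of functions of finitely many draws *)

Section finite_valued.
Context {d : measure_display} {T : measurableType d} {R : realType}.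
Variable P : probability T R.

(** [h (Y w)] is a finite combination of indicators of the fibres of [Y], so linearity of the
    integral suffices. *)
Lemma expectation_finite {V : finType} (Y : T -> V) (h : V -> R) :
  (forall v, measurable (Y @^-1` [set v])) ->
  ('E_P[fun w => h (Y w)] = (\sum_v h v * fine (P (Y @^-1` [set v])))%R%:E)%E.
Proof.
move=> mY; rewrite unlock.
rewrite (eq_integral (fun w => \sum_v ((h v)%:E * (\1_(Y @^-1` [set v]) w)%:E)%E)).
  rewrite integral_sum //; last first.
    by move=> v; apply: integrableZl => //; apply: integrable_indic.
  rewrite -sumEFin; apply: eq_bigr => v _.
  rewrite integralZl //; last exact: integrable_indic.
  by rewrite integral_indic // setIT EFinM fineK // fin_num_measure.
move=> w _; rewrite (bigD1 (Y w)) //= big1 ?adde0.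
  by rewrite indicE mem_set // mule1.
move=> v vY; rewrite indicE memNset ?mule0 //= => E.
by rewrite E eqxx in vY.
Qed.

Lemma finite_total_probability {V : finType} (Y : T -> V) :
  (forall v, measurable (Y @^-1` [set v])) ->
  \sum_v fine (P (Y @^-1` [set v])) = 1.
Proof.
move=> mY; have := expectation_finite Y (fun _ => 1) mY.
rewrite expectation_cst => -[->]; apply: eq_bigr => v _; by rewrite mul1r.
Qed.

Lemma measurable_past {V : finType} (X : nat -> T -> V) (k : nat) (F : {ffun 'I_k -> V}) :
  (forall j v, measurable (X j @^-1` [set v])) ->
  measurable ((fun w => [ffun j : 'I_k => X j w]) @^-1` [set F]).
Proof.
move=> mX.
rewrite (_ : _ @^-1` _ = \big[setI/setT]_(j < k) (X j @^-1` [set F j])).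
  by apply: bigsetI_measurable => j _; apply: mX.
rewrite -bigcap_seq; apply/seteqP; split => w /=.
  by move=> <- j _ /=; rewrite ffunE.
move=> H; apply/ffunP => j; rewrite ffunE; exact: H (mem_index_enum j).
Qed.

(** The tower property in finite form: past and next draw form one finite-valued variable, whose
    point masses factor by independence. *)
Lemma expectation_past_next {V : finType} (X : nat -> T -> V) (k : nat)
    (u : {ffun 'I_k -> V} -> V -> R) :
  (forall j v, measurable (X j @^-1` [set v])) -> independent_of_past P X ->
  ('E_P[fun w => u [ffun j : 'I_k => X j w] (X k w)] =
  (\sum_F fine (P ((fun w => [ffun j : 'I_k => X j w]) @^-1` [set F])) *
     \sum_v fine (P (X k @^-1` [set v])) * u F v)%R%:E)%E.
Proof.
move=> mX indepX.
pose past w := [ffun j : 'I_k => X j w].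
pose Y w := (past w, X k w).
have YE F v : Y @^-1` [set (F, v)] = X k @^-1` [set v] `&` past @^-1` [set F].
  by apply/seteqP; split => w /=; [case=> <- <- | case=> <- <-].
have mpast F : measurable (past @^-1` [set F]) by apply: measurable_past.
have mY p : measurable (Y @^-1` [set p]).
  by case: p => F v; rewrite YE; apply: measurableI.
rewrite (expectation_finite Y (fun p => u p.1 p.2) mY); congr _%:E.
transitivity (\sum_F \sum_v u F v * fine (P (Y @^-1` [set (F, v)]))).
  by rewrite pair_bigA; apply: eq_bigr => -[F v].
apply: eq_bigr => F _; rewrite mulr_sumr; apply: eq_bigr => v _.
have -> : P (Y @^-1` [set (F, v)]) = (P (X k @^-1` [set v]) * P (past @^-1` [set F]))%E.
  by rewrite YE; apply: indepX.
by rewrite fineM ?fin_num_measure //; rewrite mulrC [X in X * _]mulrC -mulrA.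
Qed.

End finite_valued.

(** * Dependence on the draws, and the scalar recursion *)

(** This makes the iterate at time [k] a function of a finite history. *)
Lemma eq_rcd {R : realType} {N : nat} (f : 'I_N -> R -> R) (L : 'I_N -> R) (x0 : 'rV[R]_N)
    (A B : nat -> {set 'I_N}) (k : nat) :
  (forall j, (j < k)%N -> A j = B j) -> rcd f L x0 A k = rcd f L x0 B k.
Proof.
elim: k => [//|k IHk] AB /=; rewrite AB // IHk // => j jk; apply: AB.
exact: ltnW.
Qed.

(** Induction on the product form [j%:R * (a * del j) <= 1] avoids dividing by [del j], which may
    vanish. *)
Lemma sublinear_rate {R : realFieldType} (a : R) (del : nat -> R) (k : nat) :
  0 < a -> (forall j, 0 <= del j) ->
  (forall j, del j.+1 <= del j - a * del j ^+ 2) ->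
  (0 < k)%N -> del k <= (a * k%:R)^-1.
Proof.
move=> a0 del0 step.
have claim j : j%:R * (a * del j) <= 1.
  elim: j => [|j IHj]; first by rewrite mul0r.
  set y := a * del j in IHj; set y' := a * del j.+1.
  have y0 : 0 <= y by rewrite mulr_ge0 // ltW.
  have y'0 : 0 <= y' by rewrite mulr_ge0 // ltW.
  have y'y : y' <= y - y ^+ 2.
    by have := ler_wpM2l (ltW a0) (step j); rewrite /y /y'; lra.
  (* Otherwise [y - y ^+ 2] would be negative, against [0 <= y']. *)
  have y1 : y <= 1.
    rewrite leNgt; apply/negP => y1.
    have : y * 1 < y * y by rewrite ltr_pM2l // (lt_trans ltr01).
    move: y'0 y'y; rewrite expr2; lra.
  apply: (le_trans (ler_wpM2l (ler0n _ _) y'y)).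
  (* The induction step rests on [1 - (j + 1) * (y - y ^+ 2) = (1 - j * y) * (1 - y) + y ^+ 2]. *)
  have h : 0 <= (1 - j%:R * y) * (1 - y) by rewrite mulr_ge0 // subr_ge0.
  have := sqr_ge0 y; rewrite -natr1; lra.
move=> k0; have := claim k.
have k0R : 0 < k%:R :> R by rewrite ltr0n.
rewrite -[(_ * _)^-1]mul1r ler_pdivlMr ?mulr_gt0 //.
by rewrite (_ : del k * _ = k%:R * (a * del k)) //; ring.
Qed.

Theorem theorem3p3 (R : realType) (N tau : nat)
    (f : 'I_N -> R -> R) (L : 'I_N -> R)
    (f_convex : forall i : 'I_N,
       convex_function [set: convex_lmodType R^o] (f i))
    (f_derivable : forall (i : 'I_N) (t : R), derivable (f i) t 1)
    (L_gt0 : forall i : 'I_N, 0 < L i)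
    (f_lipschitz : forall (i : 'I_N) (s t : R),
       `|derive1 (f i) s - derive1 (f i) t| <= L i * `|s - t|)
    (tau_ge2 : (2 <= tau)%N) (tau_leN : (tau <= N)%N)
    (fstar : R)
    (fstar_min : is_minimum [set objective f x | x in @feasible R N] fstar)
    (x0 : 'rV[R]_N) (x0_feasible : feasible x0)
    (rho : 'I_N -> R) (rho_gt0 : forall i : 'I_N, 0 < rho i)
    (rho_bound : forall x : 'rV[R]_N, objective f x <= objective f x0 ->
       exists2 xs : 'rV[R]_N, optimal_set f xs &
         forall i : 'I_N, `|x 0 i - xs 0 i| <= rho i)
    (d : measure_display) (T : measurableType d) (P : probability T R)
    (draw : nat -> T -> {set 'I_N})
    (draw_path : forall (k : nat) (w : T),
       draw k w \in path_sets (@complete_graph N) tau)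
    (draw_measurable : forall (k : nat) (A : {set 'I_N}),
       measurable (draw k @^-1` [set A]))
    (draw_prob : forall (k : nat) (A : {set 'I_N}),
       A \in path_sets (@complete_graph N) tau ->
       P (draw k @^-1` [set A]) = (path_prob (@complete_graph N) tau L A)%:E)
    (draw_indep : independent_of_past P draw)
    (k : nat) (k_gt0 : (1 <= k)%N) :
  ('E_P[fun w : T => objective f (rcd f L x0 (fun j : nat => draw j w) k)]
     - fstar%:E
   <= ((N%:R - 1) / (tau%:R - 1)
       * ((2 * \sum_(i < N) L i * rho i ^+ 2) / k%:R))%:E)%E.
Proof.
pose past (n : nat) (w : T) : {ffun 'I_n -> {set 'I_N}} := [ffun j : 'I_n => draw j w].
pose q n F : R := fine (P (past n @^-1` [set F])).
(* The history is padded with empty blocks from time [n] on; by [eq_rcd] the iterate at time [n]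
   does not see them. *)
pose X n (F : {ffun 'I_n -> {set 'I_N}}) : 'rV[R]_N :=
  rcd f L x0 (fun j => if insub j is Some i then F i else finset.set0) n.
have XE n w : rcd f L x0 (fun j => draw j w) n = X n (past n w).
  by apply: eq_rcd => j jn; rewrite insubT ffunE.
have mpast n F : measurable (past n @^-1` [set F]).
  exact: measurable_past draw_measurable.
have q0 n F : 0 <= q n F by rewrite /q fine_ge0.
have q1 n : \sum_F q n F = 1 by exact: finite_total_probability (mpast n).
(* Stated for arbitrary block sequences, since the sums below range over all histories, including
   those of probability zero. Descent keeps the iterates in the level set where [rho_bound]
   applies. *)
have rcd_ok A n : feasible (rcd f L x0 A n) /\ objective f (rcd f L x0 A n) <= objective f x0.
  elim: n => [//|n [fn on]] /=; split; first exact: feasible_rcd_step.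
  apply: le_trans on.
  apply: le_trans (objective_rcd_step f_derivable L_gt0 f_lipschitz _ _) _.
  by rewrite gerBl mulr_ge0 // wvar_ge0 // => i; rewrite invr_gt0.
have [[xf feas_xf obj_xf] fstar_le] := fstar_min.
have gap0 A n : 0 <= objective f (rcd f L x0 A n) - fstar.
  by rewrite subr_ge0; apply: fstar_le; exists (rcd f L x0 A n) => //; case: (rcd_ok A n).
pose del n : R := \sum_F q n F * (objective f (X n F) - fstar).
have gapE n : ('E_P[fun w : T => (objective f (rcd f L x0 (fun j => draw j w) n) - fstar)%R]
    = (del n)%:E)%E.
  rewrite (_ : (fun w => _) = fun w => objective f (X n (past n w)) - fstar).
    rewrite (expectation_finite P (past n) (fun F => objective f (X n F) - fstar) (mpast n)).
    by congr _%:E; apply: eq_bigr => F _; rewrite mulrC.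
  by apply/funext => w; rewrite XE.
have objE n : ('E_P[fun w : T => objective f (rcd f L x0 (fun j => draw j w) n)]
    = (del n + fstar)%R%:E)%E.
  rewrite (_ : (fun w => _) = fun w => objective f (X n (past n w))).
    rewrite (expectation_finite P (past n) (fun F => objective f (X n F)) (mpast n)).
    congr _%:E; rewrite /del; under [in RHS]eq_bigr do rewrite mulrBr.
    rewrite sumrB -mulr_suml q1 mul1r subrK.
    by apply: eq_bigr => F _; rewrite mulrC.
  by apply/funext => w; rewrite XE.
set D := \sum_(i < N) L i * rho i ^+ 2.
pose a := (tau%:R - 1) / (2 * (N%:R - 1) * D) : R.
have del_step n : del n.+1 <= del n - a * del n ^+ 2.
  have -> : del n.+1 = \sum_F q n F * \sum_A fine (P (draw n @^-1` [set A])) *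
      (objective f (rcd_step f L A (X n F)) - fstar).
    apply: EFin_inj; rewrite -gapE.
    rewrite -(expectation_past_next P draw n
      (fun F A => objective f (rcd_step f L A (X n F)) - fstar) draw_measurable draw_indep).
    by congr expectation; apply/funext => w /=; rewrite XE.
  have cond F : \sum_A fine (P (draw n @^-1` [set A])) *
      (objective f (rcd_step f L A (X n F)) - fstar) <=
      (objective f (X n F) - fstar)
      - a * (2 * del n * (objective f (X n F) - fstar) - del n ^+ 2).
    have [feasX leX] := rcd_ok (fun j => if insub j is Some i then F i else finset.set0) n.
    (* The optimal point depends on the history [F], but its value is always [fstar]. *)
    have [xs [feas_xs opt_xs] near_xs] := rho_bound _ leX.
    have obj_xs : objective f xs = fstar.
      apply/eqP; rewrite eq_le -{1}obj_xf opt_xs //=; apply: fstar_le.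
      by exists xs.
    have := expected_gap_rcd_step f_convex f_derivable L_gt0 f_lipschitz tau (X n F) xs rho
      (del n) tau_ge2 tau_leN feasX feas_xs rho_gt0 near_xs.
    rewrite obj_xs => /(_ (gap0 _ _)); apply: le_trans.
    (* Blocks outside [path_sets] are never drawn, so their terms vanish. *)
    rewrite (bigID (mem (path_sets (@complete_graph N) tau))) /=.
    rewrite [X in _ + X]big1 ?addr0.
      by apply: ler_sum => A pA; rewrite draw_prob.
    move=> A nA; rewrite (_ : draw n @^-1` [set A] = set0) ?measure0 ?mul0r //.
    by apply/seteqP; split => w //= E; rewrite -E draw_path in nA.
  apply: le_trans (ler_sum _ (fun F _ => ler_wpM2l (q0 n F) (cond F))) _.
  rewrite le_eqVlt; apply/orP; left; apply/eqP.
  (* The bound is affine in the gap, whose mean is [del n], so averaging turns the tangent term into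
     [2 * del n ^+ 2 - del n ^+ 2]. *)
  transitivity (\sum_F ((1 - a * 2 * del n) * (q n F * (objective f (X n F) - fstar))
     + q n F * (a * del n ^+ 2))).
    by apply: eq_bigr => F _; ring.
  rewrite big_split /= -mulr_suml q1 -mulr_sumr -/(del n); ring.
have del0 n : 0 <= del n.
  by apply: sumr_ge0 => F _; rewrite mulr_ge0 // gap0.
have N2 : (1 < N)%N by apply: leq_trans tau_leN.
have D0 : 0 < D.
  pose i0 : 'I_N := Ordinal (ltnW N2).
  rewrite /D (bigD1 i0) //= ltr_pwDl ?mulr_gt0 ?exprn_gt0 //.
  by apply: sumr_ge0 => i _; rewrite mulr_ge0 ?sqr_ge0 // ltW.
have t10 : 0 < tau%:R - 1 :> R by rewrite subr_gt0 ltr1n.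
have N10 : 0 < N%:R - 1 :> R by rewrite subr_gt0 ltr1n.
have a0 : 0 < a by rewrite divr_gt0 // !mulr_gt0.
rewrite objE -EFinB addrK lee_fin.
apply: le_trans (sublinear_rate a del k a0 del0 del_step k_gt0) _.
rewrite le_eqVlt; apply/orP; left; apply/eqP.
have k0R : 0 < k%:R :> R by rewrite ltr0n.
by rewrite /a; field; rewrite !gt_eqF.
Qed.
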